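(* Let $(X,\to,{}^*,1)$ be a Wajsberg algebra, and for $x,y\in X$ let $x\le y$ mean $x\to y=1$. Then $(X,\le,\to,1)$ is a unital commutative quantum-B algebra (with unit element $1$).
   Context: A Wajsberg algebra is an algebra $(X,\to,{}^*,1)$ of type $(2,1,0)$ such that for all $x,y,z\in X$: $1\to x=x$; $(y\to z)\to((z\to x)\to(y\to x))=1$; $(x\to y)\to y=(y\to x)\to x$; $(x^*\to y^* )\to(y\to x)=1$. A quantum-B algebra is a structure $(X,\le,\to,\rightsquigarrow)$ such that $(X,\le)$ is a partially ordered set and $\to,\rightsquigarrow$ are binary operations on $X$ satisfying, for all $x,y,z\in X$: $y\to z\le (x\to y)\to(x\to z)$; $y\rightsquigarrow z\le (x\rightsquigarrow y)\rightsquigarrow(x\rightsquigarrow z)$; $y\le z$ implies $x\to y\le x\to z$; $x\le y\to z$ iff $y\le x\rightsquigarrow z$. It is commutative if $x\to y=x\rightsquigarrow y$ for all $x,y$ (and is then written with the single operation $\to$). It is unital if there is $u\in X$ (the unit element) with $u\to x=u\rightsquigarrow x=x$ for all $x\in X$. *)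

(* Defs.v *)
From Stdlib Require Import Relation_Definitions.

Set Implicit Arguments.
Unset Strict Implicit.

Section Wajsberg.

Variables (X : Type) (imp : X -> X -> X) (neg : X -> X) (one : X).

Local Notation "x --> y" := (imp x y) (at level 55, right associativity).

Record wajsberg_algebra : Prop := {
  wajsberg_one_imp : forall x, (one --> x) = x;
  wajsberg_imp_trans : forall x y z,
    ((y --> z) --> ((z --> x) --> (y --> x))) = one;
  wajsberg_imp_comm : forall x y, ((x --> y) --> y) = ((y --> x) --> x);
  wajsberg_contrapositive : forall x y,
    ((neg x --> neg y) --> (y --> x)) = one
}.

Definition wajsberg_le : relation X := fun x y => (x --> y) = one.

End Wajsberg.

Section QuantumB.

Variables (X : Type) (le : relation X) (imp rimp : X -> X -> X).

Local Notation "x <= y" := (le x y) (at level 70, no associativity).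
Local Notation "x --> y" := (imp x y) (at level 55, right associativity).
Local Notation "x ~~> y" := (rimp x y) (at level 55, right associativity).

Record quantum_B_algebra : Prop := {
  quantum_B_order : order X le;
  quantum_B_imp : forall x y z, (y --> z) <= ((x --> y) --> (x --> z));
  quantum_B_rimp : forall x y z, (y ~~> z) <= ((x ~~> y) ~~> (x ~~> z));
  quantum_B_imp_mono : forall x y z, y <= z -> (x --> y) <= (x --> z);
  quantum_B_exchange : forall x y z, x <= (y --> z) <-> y <= (x ~~> z)
}.

Definition quantum_B_commutative : Prop := forall x y, (x --> y) = (x ~~> y).

Definition quantum_B_unit (u : X) : Prop :=
  forall x, (u --> x) = x /\ (u ~~> x) = x.

End QuantumB.

(* The single-operation form (X, <=, ->, u) is the two-operation structure
   in which both implications are [imp]. *)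
Record unital_commutative_quantum_B_algebra (X : Type) (le : relation X)
    (imp : X -> X -> X) (u : X) : Prop := {
  ucqB_quantum_B : quantum_B_algebra le imp imp;
  ucqB_commutative : quantum_B_commutative imp imp;
  ucqB_unit : quantum_B_unit imp imp u
}.

(* Main.v *)
(** Setting variables to [1] in the transitivity axiom, with the symmetry of
    [(x -> y) -> y], yields reflexivity, [x <= 1] and then [x <= y -> x]. The
    symmetry turns the latter into [x <= (x -> y) -> y], which together with
    antitonicity in the first argument gives the exchange law; exchanging
    premises in the transitivity axiom is then the first quantum-B
    inequality. *)

Require Import Defs.
From Stdlib Require Import Relation_Definitions.

Section WajsbergOrder.

Variables (X : Type) (imp : X -> X -> X) (neg : X -> X) (one : X).
Hypothesis HW : wajsberg_algebra imp neg one.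

Local Notation "x --> y" := (imp x y) (at level 55, right associativity).
Local Notation "x <= y" := (wajsberg_le imp one x y)
  (at level 70, no associativity).

Let one_imp : forall x, (one --> x) = x := wajsberg_one_imp HW.
Let imp_trans : forall x y z, y --> z <= (z --> x) --> (y --> x) :=
  wajsberg_imp_trans HW.

Lemma wajsberg_le_refl x : x <= x.
Proof.
(* This instance is [(1 -> 1) -> ((1 -> x) -> (1 -> x)) = 1], which collapses to [x -> x = 1]. *)
pose proof (imp_trans x one one) as H; red in H.
now rewrite !one_imp in H.
Qed.

Lemma wajsberg_imp_antitone x y z : x <= y -> y --> z <= x --> z.
Proof.
intros Hxy; pose proof (imp_trans z x y) as H; red in H, Hxy.
now rewrite Hxy, one_imp in H.
Qed.

Lemma wajsberg_le_trans x y z : x <= y -> y <= z -> x <= z.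
Proof.
intros Hxy Hyz; pose proof (wajsberg_imp_antitone x y z Hxy) as H.
red in H, Hyz; now rewrite Hyz, one_imp in H.
Qed.

(** When both implications equal [1], the two sides of [(x -> y) -> y = (y -> x) -> x] reduce to [y]
    and [x]. *)
Lemma wajsberg_le_antisym x y : x <= y -> y <= x -> x = y.
Proof.
intros Hxy Hyx; pose proof (wajsberg_imp_comm HW x y) as H.
red in Hxy, Hyx; now rewrite Hxy, Hyx, !one_imp in H.
Qed.

Lemma wajsberg_le_order : order X (wajsberg_le imp one).
Proof.
split.
- exact wajsberg_le_refl.
- exact wajsberg_le_trans.
- exact wajsberg_le_antisym.
Qed.

Lemma wajsberg_le_one x : x <= one.
Proof.
pose proof (imp_trans one one x) as H; red in H.
rewrite !one_imp in H.
(* Here [H] reads [x -> ((x -> 1) -> 1) = 1]; by symmetry the inner term is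
   [(1 -> x) -> x = x -> x = 1]. *)
now rewrite (wajsberg_imp_comm HW x one), one_imp, wajsberg_le_refl in H.
Qed.

Lemma wajsberg_le_imp x y : x <= y --> x.
Proof.
pose proof (wajsberg_imp_antitone y one x (wajsberg_le_one y)) as H.
now rewrite one_imp in H.
Qed.

Lemma wajsberg_le_imp_imp x y : x <= (x --> y) --> y.
Proof. rewrite (wajsberg_imp_comm HW); apply wajsberg_le_imp. Qed.

(** The chain is [y <= (y -> z) -> z <= x -> z]. *)
Lemma wajsberg_exchange x y z : x <= y --> z -> y <= x --> z.
Proof.
intros H; apply wajsberg_le_trans with ((y --> z) --> z).
- apply wajsberg_le_imp_imp.
- now apply wajsberg_imp_antitone.
Qed.

Lemma wajsberg_imp_le_imp x y z : y --> z <= (x --> y) --> (x --> z).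
Proof. apply wajsberg_exchange, imp_trans. Qed.

Lemma wajsberg_imp_mono x y z : y <= z -> x --> y <= x --> z.
Proof.
intros Hyz; pose proof (wajsberg_imp_le_imp x y z) as H; red in H, Hyz.
now rewrite Hyz, one_imp in H.
Qed.

End WajsbergOrder.

Theorem proposition4p11 (X : Type) (imp : X -> X -> X) (neg : X -> X) (one : X)
  (HW : wajsberg_algebra imp neg one) :
  unital_commutative_quantum_B_algebra (wajsberg_le imp one) imp one.
Proof.
split.
- split.
  + exact (wajsberg_le_order _ _ _ _ HW).
  + exact (wajsberg_imp_le_imp _ _ _ _ HW).
  + exact (wajsberg_imp_le_imp _ _ _ _ HW).
  + exact (wajsberg_imp_mono _ _ _ _ HW).
  (* With a single implication the law is symmetric in [x] and [y], so one lemma gives both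
     directions. *)
  + intros x y z; split; apply (wajsberg_exchange _ _ _ _ HW).
- intros x y; reflexivity.
- intros x; split; apply (wajsberg_one_imp HW).
Qed.
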